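(* Let $N\in\mathbb{N}$, $2N\le n$, $p=2N$, $S_0=\{1,\ldots,2N\}$, and let $X=(X_1,\ldots,X_{2N})\in\mathbb{R}^{n\times 2N}$ be a fair design such that for each $k\in\{1,\ldots,N\}$ the columns $X_{2k-1},X_{2k}$ are orthogonal to the space spanned by the remaining columns. Assume $\hat\rho_k:=-X_{2k-1}^TX_{2k}>0$ and write $\hat\varphi_k^2:=1-\hat\rho_k$ for all $k\in\{1,\ldots,N\}$. Then $$\Lambda_{\min}(\hat\Sigma)=\min_k\hat\varphi_k^2$$ and $$\hat\phi^2(S_0)=\frac{N}{\|1/\hat\varphi^2\|_1}\ge\Lambda_{\min}(\hat\Sigma),\qquad\hat\Gamma^2(S_0)=2\|1/\hat\varphi^2\|_1.$$ Moreover, for $\mathcal{S}=\{2,4,\ldots,2N\}$, $$\hat\phi^2(\mathcal{S})=\frac{N}{\|(1-\hat\rho^2)^{-1}\|_1}.$$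
   Context: Fair design: all columns satisfy $\|X_j\|_2=1$ and there are no $j\ne k$ and constant $b$ with $X_j=bX_k$. $\hat\Sigma:=X^TX$ and $\Lambda_{\min}$ denotes the smallest eigenvalue. Functions of vectors are entrywise: $\|1/\hat\varphi^2\|_1=\sum_{k=1}^N1/\hat\varphi_k^2$ and $\|(1-\hat\rho^2)^{-1}\|_1=\sum_{k=1}^N(1-\hat\rho_k^2)^{-1}$. For $S\subset\{1,\ldots,p\}$ and $\beta\in\mathbb{R}^p$, $\beta_S$ is the vector with entries $\beta_j$ for $j\in S$ and $0$ otherwise, and $\beta_{-S}:=\beta_{S^c}$. The compatibility constant is $\hat\phi^2(S):=\min\{|S|\,\|X\beta\|_2^2:\ \|\beta_S\|_1=1,\ \|\beta_{-S}\|_1\le 1\}$ (for $S=\{1,\ldots,p\}$ only the constraint $\|\beta_S\|_1=1$ is present), and the effective sparsity is $\hat\Gamma^2(S):=|S|/\hat\phi^2(S)$. *)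

(* Defs.v *)
From HB Require Import structures.
From mathcomp Require Import all_boot all_order all_algebra.
From mathcomp Require Import boolp classical_sets reals.
Set Implicit Arguments.
Unset Strict Implicit.
Unset Printing Implicit Defensive.
Import Order.TTheory GRing.Theory Num.Theory.
Local Open Scope classical_set_scope.
Local Open Scope ring_scope.

Definition is_minimum (R : realType) (A : set R) (m : R) : Prop :=
  A m /\ lbound A m.

(* The default value 0 is only taken when A has no minimum; an equation
   [minimum A = v] with v != 0 thus asserts that v is attained, see
   [minimum_neq0]. *)
Definition minimum (R : realType) (A : set R) : R := xget 0 (is_minimum A).

Lemma minimumE (R : realType) (A : set R) (m : R) :
  is_minimum A m -> minimum A = m.
Proof.
move=> Am; apply: xget_unique => // m' [Am' lbm'].
by case: Am => Am lbm; apply/eqP; rewrite eq_le lbm' //= lbm.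
Qed.

Lemma minimum_neq0 (R : realType) (A : set R) (m : R) :
  minimum A = m -> m != 0 -> is_minimum A m.
Proof. by rewrite /minimum; case: xgetP => [? -> ? <- //|_ <-]; rewrite eqxx. Qed.

Definition dotv (R : realType) (n : nat) (u v : 'cV[R]_n) : R :=
  (u^T *m v) 0 0.

Definition l1norm (R : realType) (n : nat) (v : 'cV[R]_n) : R :=
  \sum_i `|v i 0|.

Definition l2norm (R : realType) (n : nat) (v : 'cV[R]_n) : R :=
  Num.sqrt (\sum_i v i 0 ^+ 2).

Definition fair_design (R : realType) (n p : nat) (X : 'M[R]_(n, p)) : Prop :=
  (forall j, l2norm (col j X) = 1) /\
  (forall j k, j != k -> ~ exists b : R, col j X = b *: col k X).

Definition gram (R : realType) (n p : nat) (X : 'M[R]_(n, p)) : 'M[R]_p :=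
  X^T *m X.

Definition lambda_min (R : realType) (p : nat) (A : 'M[R]_p) : R :=
  minimum [set a : R | eigenvalue A a].

Definition col_span (R : realType) (n p : nat) (X : 'M[R]_(n, p))
    (S : {set 'I_p}) : {vspace 'cV[R]_n} :=
  <<[seq col j X | j in S]>>%VS.

Definition restrict (R : realType) (p : nat) (S : {set 'I_p})
    (beta : 'cV[R]_p) : 'cV[R]_p :=
  \col_j (if j \in S then beta j 0 else 0).

Definition compatibility (R : realType) (n p : nat) (X : 'M[R]_(n, p))
    (S : {set 'I_p}) : R :=
  minimum [set #|S|%:R * l2norm (X *m beta) ^+ 2 | beta in
            [set beta : 'cV[R]_p | l1norm (restrict S beta) = 1 /\
                                   l1norm (restrict (~: S) beta) <= 1]].

(* Real-valued: meaningful when the compatibility constant is nonzero. *)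
Definition effective_sparsity (R : realType) (n p : nat) (X : 'M[R]_(n, p))
    (S : {set 'I_p}) : R :=
  #|S|%:R / compatibility X S.

Lemma pair_fst_proof (N : nat) (k : 'I_N) : (2 * k < 2 * N)%N.
Proof. by rewrite ltn_pmul2l. Qed.

Lemma pair_snd_proof (N : nat) (k : 'I_N) : ((2 * k).+1 < 2 * N)%N.
Proof. by rewrite !mul2n ltn_Sdouble. Qed.

(* Indices start at 0: for k < N, [pair_fst k] and [pair_snd k] stand for the
   1-based column indices 2(k+1)-1 and 2(k+1). *)
Definition pair_fst (N : nat) (k : 'I_N) : 'I_(2 * N) :=
  Ordinal (pair_fst_proof k).

Definition pair_snd (N : nat) (k : 'I_N) : 'I_(2 * N) :=
  Ordinal (pair_snd_proof k).

(* Main.v *)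
(** The Gram matrix is block diagonal with blocks [[1, -rho_k], [-rho_k, 1]],
    whose eigenvalues are [1 - rho_k] and [1 + rho_k]; unit norm and
    non-collinearity of the columns force [rho_k < 1].  On one block, with
    coordinates [(x, y)], the quadratic form is at least
    [(1 - rho_k) (|x| + |y|)^2 / 2], with equality at [x = y], and at least
    [(1 - rho_k^2) y^2], with equality at [x = rho_k y].  Both compatibility
    constants thus reduce to minimising [sum_k w_k c_k^2] subject to
    [sum_k c_k = 1], whose minimum [1 / sum_k (1 / w_k)] is attained at [c_k]
    proportional to [1 / w_k]. *)
Require Import Defs.
From HB Require Import structures.
From mathcomp Require Import all_boot all_order all_algebra.
From mathcomp Require Import boolp classical_sets reals.
From mathcomp Require Import ring lra.
Set Implicit Arguments.
Unset Strict Implicit.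
Unset Printing Implicit Defensive.
Import Order.TTheory GRing.Theory Num.Theory.
Local Open Scope classical_set_scope.
Local Open Scope ring_scope.

(** * Splitting the column indices into consecutive pairs *)

Lemma pair_half_proof (N : nat) (j : 'I_(2 * N)) : (j./2 < N)%N.
Proof. by rewrite ltn_half_double -mul2n. Qed.

Definition pair_half (N : nat) (j : 'I_(2 * N)) : 'I_N :=
  Ordinal (pair_half_proof j).

Lemma pair_fstK (N : nat) : cancel (@pair_fst N) (@pair_half N).
Proof. by move=> k; apply: val_inj; rewrite /= mul2n doubleK. Qed.

Lemma pair_sndK (N : nat) : cancel (@pair_snd N) (@pair_half N).
Proof. by move=> k; apply: val_inj; rewrite /= mul2n uphalf_double. Qed.

Lemma pair_fst_snd (N : nat) (k l : 'I_N) : pair_fst k != pair_snd l.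
Proof.
by apply/eqP => /(congr1 (odd \o val)); rewrite /= !mul2n !odd_double.
Qed.

(** Serves both to regroup sums over columns pair by pair and to place a column of another pair in
    the complement that defines [col_span]. *)
Lemma pair_halfP (N : nat) (j : 'I_(2 * N)) (k : 'I_N) :
  (pair_half j == k) = (j \in [set pair_fst k; pair_snd k]%SET).
Proof.
rewrite !inE; apply/idP/idP => [/eqP <-|]; last first.
  by case/orP => /eqP ->; rewrite ?pair_fstK ?pair_sndK.
rewrite -!val_eqE /=; move: (nat_of_ord j) => m.
rewrite !mul2n -{1 3}[m]odd_double_half.
by case: (odd m); rewrite eqxx ?orbT.
Qed.

Lemma sum_pairs (V : nmodType) (N : nat) (F : 'I_(2 * N) -> V) :
  \sum_j F j = \sum_k (F (pair_fst k) + F (pair_snd k)).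
Proof.
rewrite (partition_big (@pair_half N) predT) //; apply: eq_bigr => k _.
rewrite (eq_bigl _ _ (fun j => pair_halfP j k)) big_setU1 ?big_set1 //=.
by rewrite inE pair_fst_snd.
Qed.

(** * Inner products, norms and the Gram matrix *)

Lemma dotvE (R : realType) (n : nat) (u v : 'cV[R]_n) :
  dotv u v = \sum_i u i 0 * v i 0.
Proof. by rewrite /dotv mxE; apply: eq_bigr => i _; rewrite mxE. Qed.

Lemma l2norm_sqr (R : realType) (n : nat) (v : 'cV[R]_n) :
  l2norm v ^+ 2 = dotv v v.
Proof.
rewrite sqr_sqrtr ?dotvE; last by apply: sumr_ge0 => i _; apply: sqr_ge0.
by apply: eq_bigr => i _; rewrite expr2.
Qed.

Lemma gramE (R : realType) (n p : nat) (X : 'M[R]_(n, p)) i j :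
  gram X i j = dotv (col i X) (col j X).
Proof.
by rewrite dotvE mxE; apply: eq_bigr => k _; rewrite !mxE.
Qed.

Lemma tr_gram (R : realType) (n p : nat) (X : 'M[R]_(n, p)) :
  (gram X)^T = gram X.
Proof. by rewrite /gram trmx_mul trmxK. Qed.

Lemma l2norm_gram (R : realType) (n p : nat) (X : 'M[R]_(n, p)) beta :
  l2norm (X *m beta) ^+ 2 = \sum_j beta j 0 * (gram X *m beta) j 0.
Proof. by rewrite l2norm_sqr -dotvE /dotv trmx_mul !mulmxA. Qed.

Lemma dotv_eq0 (R : realType) (n : nat) (v : 'cV[R]_n) :
  dotv v v = 0 -> v = 0.
Proof.
rewrite dotvE => /psumr_eq0P h; apply/colP => i.
have /(_ i isT) /eqP := h (fun i _ => sqr_ge0 (v i 0)).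
by rewrite mulf_eq0 orbb mxE => /eqP.
Qed.

(** For unit vectors the squared norm of [u + v] is [2 + 2 * dotv u v]. It is positive, since
    [u = - v] would be collinearity with factor -1. *)
Lemma fair_corr_lt1 (R : realType) (n p : nat) (X : 'M[R]_(n, p)) j k :
  fair_design X -> j != k -> - dotv (col j X) (col k X) < 1.
Proof.
move=> [unitX indepX] njk.
have norm1 i : dotv (col i X) (col i X) = 1 by rewrite -l2norm_sqr unitX expr1n.
set u := col j X; set v := col k X.
have E : dotv (u + v) (u + v) = 2 + 2 * dotv u v.
  transitivity (dotv u u + dotv v v + 2 * dotv u v); last by rewrite !norm1.
  rewrite !dotvE mulr_sumr -!big_split /=.
  by apply: eq_bigr => i _; rewrite !mxE; ring.
have ge0 : 0 <= dotv (u + v) (u + v) by rewrite -l2norm_sqr sqr_ge0.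
have : dotv (u + v) (u + v) != 0.
  apply/eqP => /dotv_eq0 /eqP; rewrite addr_eq0 => /eqP uv.
  by apply: (indepX _ _ njk); exists (- 1); rewrite scaleN1r.
by lra.
Qed.

(** * Block structure of the Gram matrix *)

(** Block diagonality is encoded by the action on vectors, the form in which both the quadratic form
    and the eigenvector equation consume it. *)
Definition pair_blocks (R : realType) (N : nat) (G : 'M[R]_(2 * N))
    (rho : 'I_N -> R) : Prop :=
  forall (b : 'cV[R]_(2 * N)) k,
    (G *m b) (pair_fst k) 0 = b (pair_fst k) 0 - rho k * b (pair_snd k) 0 /\
    (G *m b) (pair_snd k) 0 = b (pair_snd k) 0 - rho k * b (pair_fst k) 0.

Lemma gram_pair_blocks (R : realType) (N n : nat) (X : 'M[R]_(n, 2 * N))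
    (rho : 'I_N -> R) :
  fair_design X ->
  (forall (k : 'I_N) (v : 'cV[R]_n),
     v \in col_span X (~: [set pair_fst k; pair_snd k])%SET ->
     dotv (col (pair_fst k) X) v = 0 /\ dotv (col (pair_snd k) X) v = 0) ->
  (forall k, rho k = - dotv (col (pair_fst k) X) (col (pair_snd k) X)) ->
  pair_blocks (gram X) rho.
Proof.
move=> [unitX _] orthX rhoE b k.
have norm1 i : gram X i i = 1 by rewrite gramE -l2norm_sqr unitX expr1n.
have fs : gram X (pair_fst k) (pair_snd k) = - rho k.
  by rewrite gramE rhoE opprK.
have sf : gram X (pair_snd k) (pair_fst k) = - rho k.
  by rewrite -fs -[in LHS]tr_gram mxE.
have out l : l != k ->
    [/\ gram X (pair_fst k) (pair_fst l) = 0,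
        gram X (pair_fst k) (pair_snd l) = 0,
        gram X (pair_snd k) (pair_fst l) = 0 &
        gram X (pair_snd k) (pair_snd l) = 0].
  move=> nlk.
  have inspan j : pair_half j != k ->
      gram X (pair_fst k) j = 0 /\ gram X (pair_snd k) j = 0.
    (* A column outside pair [k] is a generator of the span to which both columns of the pair are
       orthogonal. *)
    rewrite pair_halfP -finset.in_setC => jS; rewrite !gramE; apply: orthX.
    by apply: memv_span; apply: fintype.image_f.
  have [|-> ->] := inspan (pair_fst l); first by rewrite pair_fstK.
  by have [|-> ->] := inspan (pair_snd l); first by rewrite pair_sndK.
split; rewrite mxE sum_pairs (bigD1 k) //=.
  rewrite big1 => [|l /out[-> -> _ _]]; last by rewrite !mul0r addr0.
  by rewrite norm1 fs; ring.
rewrite big1 => [|l /out[_ _ -> ->]]; last by rewrite !mul0r addr0.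
by rewrite norm1 sf; ring.
Qed.

Lemma pair_blocks_form (R : realType) (N : nat) (G : 'M[R]_(2 * N))
    (rho : 'I_N -> R) (b : 'cV[R]_(2 * N)) :
  pair_blocks G rho ->
  \sum_j b j 0 * (G *m b) j 0 =
  \sum_k (b (pair_fst k) 0 ^+ 2 + b (pair_snd k) 0 ^+ 2 -
          2 * rho k * (b (pair_fst k) 0 * b (pair_snd k) 0)).
Proof.
move=> blk; rewrite sum_pairs; apply: eq_bigr => k _.
by have [-> ->] := blk b k; ring.
Qed.

(** * Weighted sums of squares under a unit-sum constraint *)

Lemma sum_inv_gt0 (R : realType) (N : nat) (w : 'I_N -> R) :
  (0 < N)%N -> (forall k, 0 < w k) -> 0 < \sum_k (w k)^-1.
Proof.
move=> N0 w0; rewrite (bigD1 (Ordinal N0)) //=.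
rewrite ltr_pwDl ?invr_gt0 //; apply: sumr_ge0 => k _.
by rewrite invr_ge0 ltW.
Qed.

Lemma weighted_sum_sqr_ge (R : realType) (N : nat) (w c : 'I_N -> R) :
  (0 < N)%N -> (forall k, 0 < w k) -> \sum_k c k = 1 ->
  (\sum_k (w k)^-1)^-1 <= \sum_k w k * c k ^+ 2.
Proof.
move=> N0 w0 c1; have W0 := sum_inv_gt0 N0 w0.
set W := \sum_k _ in W0 *.
(* Sum [w (c - t / w) ^ 2 >= 0] with the optimal [t = 1 / W]. *)
have : \sum_k (2 * W^-1 * c k - W^-1 ^+ 2 * (w k)^-1) <= \sum_k w k * c k ^+ 2.
  apply: ler_sum => k _; rewrite -subr_ge0.
  have -> : w k * c k ^+ 2 - (2 * W^-1 * c k - W^-1 ^+ 2 * (w k)^-1) =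
            w k * (c k - W^-1 / w k) ^+ 2.
    by field; rewrite !gt_eqF.
  by rewrite mulr_ge0 ?sqr_ge0 // ltW.
rewrite sumrB -!mulr_sumr c1 -/W.
have -> // : 2 * W^-1 * 1 - W^-1 ^+ 2 * W = W^-1 by field; rewrite gt_eqF.
Qed.

(** The optimum is [1 / w] normalised to sum 1. Positivity is recorded because the [c k] become
    absolute values in the l1 constraints. *)
Lemma weighted_sum_sqr_opt (R : realType) (N : nat) (w : 'I_N -> R) :
  (0 < N)%N -> (forall k, 0 < w k) ->
  exists c : 'I_N -> R,
  [/\ forall k, 0 < c k, \sum_k c k = 1 &
      \sum_k w k * c k ^+ 2 = (\sum_k (w k)^-1)^-1].
Proof.
move=> N0 w0; have W0 := sum_inv_gt0 N0 w0.
pose c k := (w k)^-1 / \sum_l (w l)^-1; exists c.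
have c1 : \sum_k c k = 1 by rewrite -mulr_suml divff ?gt_eqF.
split=> [k|//|]; first by rewrite divr_gt0 ?invr_gt0.
rewrite -[RHS]mul1r -c1 mulr_suml; apply: eq_bigr => k _.
by rewrite /c; field; rewrite !gt_eqF.
Qed.

(** * Coordinates by pairs and restricted l1 norms *)

Definition pair_vec (R : realType) (N : nat) (a b : 'I_N -> R) :
    'cV[R]_(2 * N) :=
  \col_j (if odd j then b (pair_half j) else a (pair_half j)).

Lemma pair_vec_fst (R : realType) (N : nat) (a b : 'I_N -> R) k :
  pair_vec a b (pair_fst k) 0 = a k.
Proof. by rewrite mxE /= mul2n odd_double pair_fstK. Qed.

Lemma pair_vec_snd (R : realType) (N : nat) (a b : 'I_N -> R) k :
  pair_vec a b (pair_snd k) 0 = b k.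
Proof. by rewrite mxE /= mul2n odd_double /= pair_sndK. Qed.

Lemma l1norm_pairs (R : realType) (N : nat) (b : 'cV[R]_(2 * N)) :
  l1norm b = \sum_k (`|b (pair_fst k) 0| + `|b (pair_snd k) 0|).
Proof. exact: sum_pairs. Qed.

Lemma l1norm_restrictT (R : realType) (p : nat) (b : 'cV[R]_p) :
  l1norm (restrict [set: 'I_p]%SET b) = l1norm b.
Proof. by apply: eq_bigr => i _; rewrite mxE inE. Qed.

Lemma l1norm_restrictCT (R : realType) (p : nat) (b : 'cV[R]_p) :
  l1norm (restrict (~: [set: 'I_p])%SET b) = 0.
Proof. by rewrite /l1norm big1 // => i _; rewrite mxE !inE normr0. Qed.

Lemma mem_pair_snd (N : nat) (k : 'I_N) :
  (pair_fst k \in [set pair_snd l | l : 'I_N]%SET) = false /\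
  pair_snd k \in [set pair_snd l | l : 'I_N]%SET.
Proof.
split; last exact: imset_f.
by apply/negbTE/imsetP => -[l _ /eqP]; apply/negP/pair_fst_snd.
Qed.

Lemma l1norm_restrict_snd (R : realType) (N : nat) (b : 'cV[R]_(2 * N)) :
  l1norm (restrict [set pair_snd l | l : 'I_N]%SET b) =
  \sum_k `|b (pair_snd k) 0|.
Proof.
rewrite l1norm_pairs; apply: eq_bigr => k _; rewrite !mxE.
by have [-> ->] := mem_pair_snd k; rewrite normr0 add0r.
Qed.

Lemma l1norm_restrictC_snd (R : realType) (N : nat) (b : 'cV[R]_(2 * N)) :
  l1norm (restrict (~: [set pair_snd l | l : 'I_N])%SET b) =
  \sum_k `|b (pair_fst k) 0|.
Proof.
rewrite l1norm_pairs; apply: eq_bigr => k _; rewrite !mxE !inE.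
by have [-> ->] := mem_pair_snd k; rewrite normr0 addr0.
Qed.

(** * The two compatibility constants *)

Lemma compatibility_setT (R : realType) (N n : nat) (X : 'M[R]_(n, 2 * N))
    (rho : 'I_N -> R) :
  (0 < N)%N -> pair_blocks (gram X) rho -> (forall k, 0 < rho k < 1) ->
  compatibility X [set: 'I_(2 * N)]%SET = N%:R / \sum_k (1 - rho k)^-1.
Proof.
move=> N0 blk rho01.
have w0 k : 0 < 1 - rho k by have := rho01 k; lra.
have W0 := sum_inv_gt0 N0 w0.
apply: minimumE; split; last first.
  move=> _ /= [b [] + _ <-].
  rewrite l1norm_restrictT l1norm_pairs l2norm_gram (pair_blocks_form _ blk).
  rewrite cardsT card_ord natrM => b1.
  have := weighted_sum_sqr_ge N0 w0 b1.
  (* The factor 2 comes from the cardinality [2 * N]; the other factor [N] stays outside the sum. *)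
  have : \sum_k (1 - rho k) *
           (`|b (pair_fst k) 0| + `|b (pair_snd k) 0|) ^+ 2 <=
         \sum_k 2 * (b (pair_fst k) 0 ^+ 2 + b (pair_snd k) 0 ^+ 2 -
           2 * rho k * (b (pair_fst k) 0 * b (pair_snd k) 0)).
    apply: ler_sum => k _; have /andP[r0 r1] := rho01 k.
    set x := b _ 0; set y := b _ 0.
    (* As [rho k > 0], replacing [x * y] by the product of absolute values only lowers the form. The
       remaining difference of the two sides is then [(1 + rho k) * (|x| - |y|) ^ 2]. *)
    have xy : x * y <= `|x| * `|y| by rewrite -normrM ler_norm.
    rewrite -(real_normK (num_real x)) -(real_normK (num_real y)).
    have rxy := ler_wpM2l (ltW r0) xy.
    have := mulr_ge0 (ltW r0) (sqr_ge0 (`|x| - `|y|)).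
    by have := sqr_ge0 (`|x| - `|y|); nra.
  rewrite -mulr_sumr => le1 le2.
  by rewrite [2%:R * _]mulrC -mulrA ler_wpM2l // (le_trans le2).
have [c [c0 c1 copt]] := weighted_sum_sqr_opt N0 w0.
(* Equality on a block needs equal coordinates, so the mass [c k] is shared evenly. *)
exists (pair_vec (fun k => c k / 2) (fun k => c k / 2)).
  split; last by rewrite l1norm_restrictCT.
  rewrite l1norm_restrictT l1norm_pairs -[RHS]c1; apply: eq_bigr => k _.
  rewrite pair_vec_fst pair_vec_snd ger0_norm; last by rewrite divr_ge0 // ltW.
  by field.
rewrite l2norm_gram (pair_blocks_form _ blk) cardsT card_ord natrM -copt.
rewrite !mulr_sumr; apply: eq_bigr => k _.
by rewrite pair_vec_fst pair_vec_snd; field.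
Qed.

(** For a fixed second coordinate [y], the block form is minimal at first coordinate [rho k * y].
    This choice is admissible because [rho k < 1] keeps the l1 norm off the set at most 1. *)
Lemma compatibility_snd (R : realType) (N n : nat) (X : 'M[R]_(n, 2 * N))
    (rho : 'I_N -> R) :
  (0 < N)%N -> pair_blocks (gram X) rho -> (forall k, 0 < rho k < 1) ->
  compatibility X [set pair_snd k | k : 'I_N]%SET =
  N%:R / \sum_k (1 - rho k ^+ 2)^-1.
Proof.
move=> N0 blk rho01.
have w0 k : 0 < 1 - rho k ^+ 2 by have := rho01 k; nra.
have W0 := sum_inv_gt0 N0 w0.
rewrite /compatibility card_imset; last exact: can_inj (@pair_sndK N).
rewrite card_ord.
apply: minimumE; split; last first.
  move=> _ /= [b [] + _ <-].
  rewrite l1norm_restrict_snd l2norm_gram (pair_blocks_form _ blk) => b1.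
  rewrite ler_wpM2l //; apply: le_trans (weighted_sum_sqr_ge N0 w0 b1) _.
  apply: ler_sum => k _; rewrite real_normK ?num_real //.
  rewrite -subr_ge0; set x := b _ 0; set y := b _ 0.
  (* The difference of the two sides is exactly this square. *)
  by have := sqr_ge0 (x - rho k * y); lra.
have [c [c0 c1 copt]] := weighted_sum_sqr_opt N0 w0.
exists (pair_vec (fun k => rho k * c k) c).
  rewrite /= l1norm_restrict_snd l1norm_restrictC_snd; split.
    by rewrite -[RHS]c1; apply: eq_bigr => k _; rewrite pair_vec_snd gtr0_norm.
  rewrite -[leRHS]c1; apply: ler_sum => k _; have /andP[r0 r1] := rho01 k.
  by rewrite pair_vec_fst gtr0_norm ?mulr_gt0 // ger_pMl // ltW.
rewrite l2norm_gram (pair_blocks_form _ blk) -copt; congr (_ * _).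
by apply: eq_bigr => k _; rewrite pair_vec_fst pair_vec_snd; ring.
Qed.

(** * The smallest eigenvalue *)

(** [eigenvalue] refers to row vectors; symmetry of the Gram matrix lets transposition pass to
    columns. *)
Lemma gram_eigenvalueP (R : realType) (n p : nat) (X : 'M[R]_(n, p)) a :
  reflect (exists2 b : 'cV[R]_p, gram X *m b = a *: b & b != 0)
          (eigenvalue (gram X) a).
Proof.
apply: (iffP eigenvalueP) => -[b bE b0]; exists b^T.
- by rewrite -tr_gram -trmx_mul bE linearZ.
- by rewrite trmx_eq0.
- by rewrite -tr_gram -trmx_mul bE linearZ.
- by rewrite trmx_eq0.
Qed.

Lemma lambda_min_pair_blocks (R : realType) (N n : nat)
    (X : 'M[R]_(n, 2 * N)) (rho : 'I_N -> R) (k0 : 'I_N) :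
  pair_blocks (gram X) rho -> (forall k, 0 < rho k) ->
  (forall k, 1 - rho k0 <= 1 - rho k) ->
  lambda_min (gram X) = 1 - rho k0.
Proof.
move=> blk rho0 k0min; apply: minimumE; split.
  apply/gram_eigenvalueP.
  (* The eigenvector has both coordinates of pair [k0] equal to 1 and all others 0. *)
  pose d k : R := (k == k0)%:R; exists (pair_vec d d); last first.
    apply/eqP => /colP /(_ (pair_fst k0)) /eqP.
    by rewrite pair_vec_fst /d eqxx mxE oner_eq0.
  have dE k : d k - rho k * d k = (1 - rho k0) * d k.
    by rewrite /d; case: eqP => [->|_] /=; ring.
  apply/colP => j.
  have := pair_halfP j (pair_half j); rewrite eqxx !inE => /esym.
  have [Ef Es] := blk (pair_vec d d) (pair_half j).
  by case/orP => /eqP ->; rewrite ?Ef ?Es [RHS]mxE pair_vec_fst pair_vec_snd.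
move=> a /gram_eigenvalueP [b bE /eqP b0].
(* Rayleigh argument: the form at an eigenvector [b] is [a * dotv b b], and it is at least
   [(1 - rho k0) * dotv b b]. A smaller [a] would force [b = 0]. *)
rewrite -subr_ge0 leNgt; apply/negP => alt; apply: b0; apply: dotv_eq0.
have form_ge : (1 - rho k0) * dotv b b <= a * dotv b b.
  have -> : a * dotv b b = \sum_j b j 0 * (gram X *m b) j 0.
    by rewrite bE dotvE mulr_sumr; apply: eq_bigr => j _; rewrite mxE mulrCA.
  rewrite (pair_blocks_form _ blk) dotvE sum_pairs mulr_sumr.
  apply: ler_sum => k _.
  set x := b _ 0; set y := b _ 0.
  have := ler_wpM2r (addr_ge0 (sqr_ge0 x) (sqr_ge0 y)) (k0min k).
  (* The block form equals [(1 - rho k) * (x ^+ 2 + y ^+ 2) + rho k * (x - y) ^+ 2]. *)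
  by have := mulr_ge0 (ltW (rho0 k)) (sqr_ge0 (x - y)); nra.
have := sqr_ge0 (l2norm b); rewrite l2norm_sqr => ge0.
by apply/eqP; rewrite eq_le ge0 andbT; nra.
Qed.

Theorem lemma7p1 (R : realType) (N n : nat) (X : 'M[R]_(n, 2 * N))
    (rho phi2 : 'I_N -> R) :
  (0 < N)%N ->
  (2 * N <= n)%N ->
  fair_design X ->
  (forall (k : 'I_N) (v : 'cV[R]_n),
     v \in col_span X (~: [set pair_fst k; pair_snd k])%SET ->
     dotv (col (pair_fst k) X) v = 0 /\ dotv (col (pair_snd k) X) v = 0) ->
  (forall k, rho k = - dotv (col (pair_fst k) X) (col (pair_snd k) X)) ->
  (forall k, 0 < rho k) ->
  (forall k, phi2 k = 1 - rho k) ->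
  [/\ lambda_min (gram X) = minimum [set phi2 k | k in [set: 'I_N]],
      compatibility X [set: 'I_(2 * N)]%SET
        = N%:R / l1norm (\col_k (1 / phi2 k)),
      compatibility X [set: 'I_(2 * N)]%SET >= lambda_min (gram X),
      effective_sparsity X [set: 'I_(2 * N)]%SET
        = 2 * l1norm (\col_k (1 / phi2 k)) &
      compatibility X [set pair_snd k | k : 'I_N]%SET
        = N%:R / l1norm (\col_k (1 - rho k ^+ 2)^-1)].
Proof.
move=> N0 _ fairX orthX rhoE rho0 phiE.
have blk := gram_pair_blocks fairX orthX rhoE.
have rho01 k : 0 < rho k < 1.
  by rewrite rho0 rhoE (fair_corr_lt1 fairX) // pair_fst_snd.
have w0 k : 0 < 1 - rho k by have := rho01 k; lra.
have W0 := sum_inv_gt0 N0 w0.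
have phi_norm : l1norm (\col_k (1 / phi2 k)) = \sum_k (1 - rho k)^-1.
  by apply: eq_bigr => k _; rewrite mxE phiE div1r gtr0_norm ?invr_gt0.
have rho_norm : l1norm (\col_k (1 - rho k ^+ 2)^-1) =
                \sum_k (1 - rho k ^+ 2)^-1.
  apply: eq_bigr => k _; rewrite mxE ger0_norm // invr_ge0.
  by have := rho01 k; nra.
(* The index set is finite and, as [0 < N], nonempty, so the minimum is attained. *)
have [k0 _ k0min] :=
  @arg_minP _ R _ (Ordinal N0) xpredT (fun k => 1 - rho k) isT.
have {}k0min k : 1 - rho k0 <= 1 - rho k by exact: k0min.
have lamE := lambda_min_pair_blocks blk rho0 k0min.
have compT := compatibility_setT N0 blk rho01.
rewrite compT phi_norm rho_norm (compatibility_snd N0 blk rho01) lamE.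
rewrite /effective_sparsity compT cardsT card_ord; split => //.
- apply/esym/minimumE; split; first by exists k0; rewrite ?phiE.
  by move=> _ [k _ <-]; rewrite phiE.
(* The minimum is at most the harmonic mean: each of the [N] summands [(1 - rho k0) / (1 - rho k)]
   is at most 1. *)
- rewrite ler_pdivlMr // mulr_sumr.
  rewrite -[leRHS]/(N%:R) -[in leRHS](card_ord N) -sumr_const.
  by apply: ler_sum => k _; rewrite ler_pdivrMr // mul1r.
(* Both [N] and the sum of inverses are nonzero, so the compatibility constant is nonzero and the
   quotient is a genuine division. *)
- by rewrite natrM; field; rewrite (gt_eqF W0) pnatr_eq0 -lt0n.
Qed.
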